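(* Let $\bar\Xi$ be a generic target-cycle (possibly with repeated targets) traversed repeatedly by a single agent that, after arriving at any target $n\in\bar\Xi$, leaves it if and only if the target uncertainty $R_n$ reaches zero, and let $\Xi$ be the equivalent unconstrained version of $\bar\Xi$. Assume that the dwell time dynamics of $\bar\Xi$ have a feasible and globally asymptotically stable equilibrium point. Then the steady state mean cycle uncertainty of $\bar\Xi$ is $$J_{ss}(\bar\Xi)=\frac12(\bar B_\Xi-\bar A_\Xi)^T\bar\tau_\Xi,$$ where $$\bar\tau_\Xi=[\mathrm{diag}(\bar\gamma_\Xi)-\mathbf 1_\Xi]^{-1}\mathbf 1_\Xi\,\bar\rho_\Xi$$ is the vector of steady state dwell times, and $\bar A_\Xi,\bar B_\Xi\in\mathbb R^{|\Xi|}$ are the vectors whose entries corresponding to the element $n^j\in\Xi$ are respectively $$A_n^j=\frac{T_n^j}{T_\Xi}\,\frac{\tau_n^j(B_n-A_n)}{T_\Xi-\tau_n^j},\qquad B_n^j=\frac{T_n^j(B_n-A_n)}{T_\Xi-\tau_n^j},$$ with $\tau_n^j$ the entry of $\bar\tau_\Xi$ corresponding to $n^j$, $T_n^j=(\bar 1_n^j)^T(\bar\rho_\Xi+\bar\tau_\Xi)$ and $T_\Xi=\bar 1_{|\Xi|}^T(\bar\rho_\Xi+\bar\tau_\Xi)$.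
   Context: Targets are the nodes of a directed graph $\mathcal G=(\mathcal V,\mathcal E)$; travelling along edge $(i,j)\in\mathcal E$ takes a fixed time $\rho_{ij}\ge0$. Each target $i$ has an uncertainty state $R_i(t)\ge0$ with given $R_i(0)$ and parameters $A_i>0$, $B_i>0$, with dynamics: $\dot R_i(t)=0$ if $R_i(t)=0$ and $A_i\le B_iN_i(t)$, and $\dot R_i(t)=A_i-B_iN_i(t)$ otherwise, where $N_i(t)$ is the number of agents present at target $i$ at time $t$ (here $0$ or $1$). A target-cycle $\bar\Xi$ is a finite sequence of targets such that cyclically consecutive targets are joined by edges of $\mathcal E$; it is constrained if some target occurs more than once. The agent follows the sequence cyclically forever, dwelling at each visited target and then travelling to the next; one pass through the sequence is a tour. The steady state mean cycle uncertainty is $J_{ss}(\bar\Xi)=\lim_{T\to\infty}\frac1T\int_0^T\sum_{j}R_j(t)\,dt$, the sum being over the distinct targets $j$ occurring in $\bar\Xi$. Equivalent unconstrained version: if target $i$ occurs $n_i$ times in $\bar\Xi$, replace its $j$-th occurrence by an auxiliary target $i^j$, $j=1,\ldots,n_i$; the resulting sequence of distinct elements is $\Xi$, of length $|\Xi|$ equal to the length of $\bar\Xi$. (A target occurring once is treated as having the single element $i^1$, for which the displayed formulas return its original parameters.) The sub-cycle $\Xi_i^j\subset\Xi$ of $i^j$ starts (cyclically) with the element immediately following $i^{j-1}$ (with $i^0:=i^{n_i}$) and ends with $i^j$; if $n_i=1$ then $\Xi_i^1=\Xi$. The sub-cycle unit vector $\bar 1_i^j\in\{0,1\}^{|\Xi|}$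 has $p$-th entry $1$ exactly when the $p$-th element of $\Xi$ belongs to $\Xi_i^j$; $\bar 1_{|\Xi|}$ is the all-ones vector. The sub-cycle matrix $\mathbf 1_\Xi\in\mathbb R^{|\Xi|\times|\Xi|}$ has as its $p$-th row the (transposed) sub-cycle unit vector of the $p$-th element of $\Xi$. The vector $\bar\gamma_\Xi\in\mathbb R^{|\Xi|}$ has $p$-th entry $B_i/A_i$ if the $p$-th target of $\bar\Xi$ is $i$. The travel time vector $\bar\rho_\Xi\in\mathbb R^{|\Xi|}$ has $p$-th entry the travel time to the $p$-th target of $\bar\Xi$ from its cyclic predecessor. Dwell time dynamics: the tour-to-tour recursion for the vector $\bar\tau_{\Xi,k}\in\mathbb R^{|\Xi|}$ of dwell times in the $k$-th tour induced by the leave-at-zero behaviour, i.e. for each visit $i^j$, $(B_i-A_i)$ times its dwell time equals $A_i$ times the time elapsed between the agent's previous departure from $i$ and its present arrival at $i$ (sum of the travel times over $\Xi_i^j$ and of the most recent dwell times at the elements of $\Xi_i^j$ other than $i^j$). An equilibrium is feasible if its components are non-negative; the steady state dwell times $\bar\tau_\Xi$ are the components of the equilibrium, to which $\bar\tau_{\Xi,k}$ converges as $k\to\infty$. *)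

(* Defs.v *)
From HB Require Import structures.
From mathcomp Require Import all_boot all_order all_algebra.
From mathcomp Require Import all_classical all_reals all_analysis.

Set Implicit Arguments.
Unset Strict Implicit.
Unset Printing Implicit Defensive.

Import Order.TTheory GRing.Theory Num.Theory.
Import numFieldNormedType.Exports.

Local Open Scope classical_set_scope.
Local Open Scope ring_scope.

(** A target-cycle of length [n.+1] is a map [xi : 'I_n.+1 -> V].  The elements
    of its equivalent unconstrained version are pairwise distinct and listed in
    the same order, so the element [i^j] is represented by its position: [p]
    stands for [i^j] with [i = xi p] and [j = occ_index xi p] (counted from 1). *)
Section Cycle.
Context (V : finType) (n : nat) (xi : 'I_n.+1 -> V).
Implicit Types p q : 'I_n.+1.

Definition occ_count (i : V) : nat := #|[set q | xi q == i]%SET|.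

Definition occ_index p : nat :=
  #|[set q : 'I_n.+1 | (q <= p)%N && (xi q == xi p)]%SET|.

(** Position of [i^(j-1)], with [i^0 = i^(n_i)]; the [pick] never fails. *)
Definition prev_occ p : 'I_n.+1 :=
  odflt p [pick q | (xi q == xi p) &&
    (occ_index q == (if occ_index p == 1%N then occ_count (xi p)
                     else (occ_index p).-1))].

(** The cyclic interval from the successor [s] of [i^(j-1)] to [i^j]: the
    subtractions are modulo [n.+1], so [q - s] is the number of steps leading
    from [s] forward to [q].  If [i] occurs once, this is the whole cycle. *)
Definition subcycle p : {set 'I_n.+1} :=
  let s := ordS (prev_occ p) in
  [set q : 'I_n.+1 | (nat_of_ord (q - s)%R <= nat_of_ord (p - s)%R)%N]%SET.

(** Target of the [k]-th visit, [k = 0, 1, ...], with [k] reduced mod [n.+1]. *)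
Definition visited (k : nat) : V := xi (inZp k).

End Cycle.

Section Vectors.
Context (R : realType) (V : finType) (n : nat) (xi : 'I_n.+1 -> V).
Context (rho : V -> V -> R) (A B : V -> R).
Implicit Types (p q : 'I_n.+1) (tau : 'cV[R]_n.+1).

Definition subcycle_vec p : 'cV[R]_n.+1 := \col_q (q \in subcycle xi p)%:R.

Definition subcycle_mx : 'M[R]_n.+1 := \matrix_p (subcycle_vec p)^T.

Definition gamma_vec : 'cV[R]_n.+1 := \col_p (B (xi p) / A (xi p)).

Definition travel_vec : 'cV[R]_n.+1 := \col_p rho (xi (ord_pred p)) (xi p).

Definition steady_dwell : 'cV[R]_n.+1 :=
  invmx (diag_mx gamma_vec^T - subcycle_mx) *m subcycle_mx *m travel_vec.

Definition subcycle_time tau p : R :=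
  ((subcycle_vec p)^T *m (travel_vec + tau)) ord0 ord0.

Definition cycle_time tau : R :=
  ((const_mx 1 : 'cV[R]_n.+1)^T *m (travel_vec + tau)) ord0 ord0.

Definition A_vec tau : 'cV[R]_n.+1 :=
  \col_p (subcycle_time tau p / cycle_time tau *
          (tau p ord0 * (B (xi p) - A (xi p)) / (cycle_time tau - tau p ord0))).

Definition B_vec tau : 'cV[R]_n.+1 :=
  \col_p (subcycle_time tau p * (B (xi p) - A (xi p)) /
          (cycle_time tau - tau p ord0)).

(** One step of the dwell time dynamics, from the dwell times [tau] of a tour to
    the dwell times [tau'] of the next one.  On arrival at position [p], the
    most recent visit to position [q] belongs to the current tour when [q < p]
    and to the previous one when [p < q]. *)
Definition dwell_step tau tau' : Prop :=
  forall p, (B (xi p) - A (xi p)) * tau' p ord0 =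
    A (xi p) * (\sum_(q in subcycle xi p) travel_vec q ord0
                + \sum_(q in subcycle xi p | (q < p)%N) tau' q ord0
                + \sum_(q in subcycle xi p | (p < q)%N) tau q ord0).

End Vectors.

(** Global asymptotic stability of the equilibrium [x] of a discrete-time system
    given by the relation [step] between successive states. *)
Section Stability.
Context (R : realType) (W : normedModType R) (step : W -> W -> Prop).

Definition orbit_of (u : nat -> W) : Prop := forall k, step (u k) (u k.+1).

Definition lyapunov_stable (x : W) : Prop :=
  forall e : R, 0 < e -> exists2 d : R, 0 < d &
    forall u, orbit_of u -> `|u 0%N - x| < d -> forall k, `|u k - x| < e.

Definition globally_attractive (x : W) : Prop :=
  forall u, orbit_of u -> u k @[k --> \oo] --> x.

Definition globally_asymptotically_stable (x : W) : Prop :=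
  [/\ step x x, lyapunov_stable x & globally_attractive x].

End Stability.

Section Trajectory.
Context (R : realType) (V : finType) (n : nat) (xi : 'I_n.+1 -> V).
Context (rho : V -> V -> R) (A B : V -> R).

Definition uncertainty_rate (a b r : R) (m : nat) : R :=
  if (r == 0) && (a <= b * m%:R) then 0 else a - b * m%:R.

(** [arr k] and [dep k] are the arrival and departure times of the [k]-th visit. *)
Definition agents_at (arr dep : nat -> R) (i : V) (t : R) : nat :=
  `[< exists k, visited xi k = i /\ arr k <= t <= dep k >].

Definition switching_time (arr dep : nat -> R) (i : V) (t : R) : Prop :=
  exists k, visited xi k = i /\ (t = arr k \/ t = dep k).

(** [unc i t] is the uncertainty of target [i] at time [t >= 0].  It has corners
    when the agent arrives at or departs from [i]; the differential equation is
    required at all other positive times, and continuity everywhere.  The agent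
    may still be travelling to its first target at time 0.  [traj_forever]
    excludes accumulation of visits in finite time, so that the motion is
    defined on the whole of [0, +oo[. *)
Record leave_at_zero_trajectory (arr dep : nat -> R) (unc : V -> R -> R) : Prop :=
  LeaveAtZeroTrajectory {
    traj_start : 0 <= arr 0%N;
    traj_dwell : forall k, arr k <= dep k;
    traj_travel : forall k,
      arr k.+1 = dep k + rho (visited xi k) (visited xi k.+1);
    traj_forever : arr k @[k --> \oo] --> +oo;
    traj_leave : forall k, unc (visited xi k) (dep k) = 0;
    traj_stay : forall k t, arr k <= t < dep k -> unc (visited xi k) t != 0;
    traj_ge0 : forall i t, 0 <= t -> 0 <= unc i t;
    traj_continuous : forall i, {within `[0, +oo[, continuous (unc i)};
    traj_dynamics : forall i t, 0 < t -> ~ switching_time arr dep i t ->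
      is_derive t (1 : R) (unc i)
        (uncertainty_rate (A i) (B i) (unc i t) (agents_at arr dep i t))
  }.

Definition tour_dwell (arr dep : nat -> R) (k : nat) : 'cV[R]_n.+1 :=
  \col_(p < n.+1) (dep (k * n.+1 + p)%N - arr (k * n.+1 + p)%N).

Definition mean_cycle_uncertainty (unc : V -> R -> R) (T : R) : R :=
  T^-1 * \int[lebesgue_measure]_(t in `[0, T]) (\sum_(j in codom xi) unc j t).

End Trajectory.

(* Main.v *)
Require Import Defs.
From HB Require Import structures.
From mathcomp Require Import all_boot all_order all_algebra.
From mathcomp Require Import all_classical all_reals all_analysis.
From mathcomp Require Import zify ring lra.

(** Between two consecutive departures from a target, its uncertainty starts and
    ends at zero; it grows at rate [A] during the absence of the agent and
    changes at rate [A - B] during the dwell.  Its graph is thus a triangle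
    ([uncertainty_triangle]), whose height is both [A] times the absence and
    [B - A] times the dwell time.  The first equality of heights says that the
    dwell times of successive tours form an orbit of the dwell time dynamics
    ([tour_dwell_orbit]), so that attractivity makes them converge to the
    equilibrium.  Attractivity also makes the equilibrium unique, whence the
    invertibility of the matrix ([dwell_mx_unit]) and the closed form of the
    steady state dwell times.

    The area of the triangle is half its base, the time between the departures,
    times its height.  In the limit the base at position [p] is the sub-cycle
    time [T_p] and the height is [(B - A) tau_p].  During one tour, which takes
    the time [T] in the limit, each position contributes one triangle, so the
    mean is the sum over [p] of [T_p (B - A) tau_p / (2 T)].  To make this precise,
    the integral of the uncertainty of a single target is sampled at the
    departures from one of its occurrences: the increments over a tour are sums
    of areas of triangles ([integral_window]), and a Stolz-Cesaro argument
    ([mean_of_slopes]) turns their limits into the limit of the time mean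
    ([target_mean_cvg]).  Apart from degenerate cases, [(B_vec - A_vec) p] equals
    [T_p (B - A) / T] ([mean_uncertainty_entry]).

    Two degenerate situations need care.  If [T = 0], quotients by [T] are zero by
    convention, and the mean does tend to zero because the heights of all
    triangles do ([slope_degenerate]).  If [T = tau_p], the denominator in [A_vec]
    and [B_vec] vanishes, but so does the height at [p] ([triangle_height0]). *)

Set Implicit Arguments.
Unset Strict Implicit.
Unset Printing Implicit Defensive.

Import Order.TTheory GRing.Theory Num.Theory.
Import numFieldNormedType.Exports.

Local Open Scope classical_set_scope.
Local Open Scope ring_scope.

(** * Consecutive visits to a target *)

Section PreviousVisit.
Context (V : finType) (n : nat) (xi : 'I_n.+1 -> V).
Implicit Types p q : 'I_n.+1.

Lemma occ_index_lt p q : xi q = xi p -> (q < p)%N ->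
  (occ_index xi q < occ_index xi p)%N.
Proof.
move=> eqx ltqp; apply/proper_card/properP; split.
  by apply/fintype.subsetP => r; rewrite !inE eqx => /andP[+ ->]; lia.
by exists p; rewrite !inE ?leqnn ?eqxx//=; lia.
Qed.

Lemma occ_index_le_count p : (occ_index xi p <= occ_count xi (xi p))%N.
Proof. by apply/subset_leq_card/fintype.subsetP => r; rewrite !inE => /andP[]. Qed.

Lemma occ_index_gt0 p : (0 < occ_index xi p)%N.
Proof. by apply/card_gt0P; exists p; rewrite !inE leqnn eqxx. Qed.

Lemma last_occ_index p : (forall q, xi q = xi p -> (q <= p)%N) ->
  occ_index xi p = occ_count xi (xi p).
Proof.
move=> lastp; apply: eq_card => q; rewrite !inE.
by case: eqP => [/lastp->|]; rewrite ?andbT ?andbF.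
Qed.

Lemma occ_index_next p r : xi r = xi p -> (r < p)%N ->
  (forall q, xi q = xi p -> (q < p)%N -> (q <= r)%N) ->
  occ_index xi p = (occ_index xi r).+1.
Proof.
move=> xr rp maxr; rewrite /occ_index (cardsD1 p) !inE leqnn eqxx add1n.
congr _.+1; apply: eq_card => q; rewrite !inE xr.
case: (eqVneq (xi q) (xi p)) => [xq|]; rewrite ?andbF// !andbT.
apply/andP/idP => [[qp leqp]|leqr].
  by apply: maxr => //; rewrite ltn_neqAle leqp andbT.
by split; [apply/eqP => qp; move: leqr; rewrite qp|]; lia.
Qed.

(** The [pick] defining [prev_occ] succeeds: the last occurrence of the target in
    the cycle has index [occ_count], and the last one before [p] has the index
    just below that of [p]. *)
Lemma prev_occ_spec p : let r := prev_occ xi p in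
  xi r = xi p /\ occ_index xi r = (if occ_index xi p == 1%N
                                   then occ_count xi (xi p)
                                   else (occ_index xi p).-1).
Proof.
rewrite /prev_occ; case: pickP => /= [r /andP[/eqP-> /eqP->]//|noprev].
have [idx1|idx1] := eqVneq (occ_index xi p) 1%N.
  have Pp : xi p == xi p by [].
  case: (@arg_maxnP _ p (fun q => xi q == xi p) val Pp) => r /eqP xr maxr.
  move: (noprev r); rewrite xr eqxx idx1/= -xr last_occ_index ?eqxx// => q xq.
  by apply: maxr; rewrite /= xq xr.
have [q0 Pq0] : exists q0, (xi q0 == xi p) && (q0 < p)%N.
  apply/existsP/contraT; rewrite negb_exists => /forallP none.
  case/negP: idx1; rewrite /occ_index; apply/cards1P; exists p.
  apply/setP => q; rewrite !inE; have := none q.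
  case: eqP => [xq|xq] /=; rewrite ?andbT ?andbF.
    by rewrite -leqNgt => pq; rewrite -val_eqE/= eqn_leq pq andbT.
  by move=> _; apply/esym/eqP => qp; rewrite qp in xq.
case: (@arg_maxnP _ q0 (fun q => (xi q == xi p) && (q < p)%N) val Pq0).
move=> r /andP[/eqP xr rp] maxr.
have idxp : occ_index xi p = (occ_index xi r).+1.
  by apply: occ_index_next => // q xq qp; apply: maxr; rewrite xq eqxx.
by have := noprev r; rewrite xr eqxx (negbTE idx1) idxp /= eqxx.
Qed.

Lemma xi_prev_occ p : xi (prev_occ xi p) = xi p.
Proof. by case: (prev_occ_spec p). Qed.

(** Occurrence indices increase strictly along the cycle, so none fits between
    those of [prev_occ p] and [p].  In the second case the way from [prev_occ p]
    to [p] passes the end of the cycle; this includes [prev_occ p = p], where it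
    is the whole cycle. *)
Lemma no_visit_after_prev p q : xi q = xi p ->
  (if prev_occ xi p < p then prev_occ xi p < q < p
   else (prev_occ xi p < q) || (q < p))%N = false.
Proof.
case: (prev_occ_spec p); set r := prev_occ xi p => xr idxr xq.
have xqr : xi q = xi r by rewrite xr.
have idxq0 := occ_index_gt0 q; have idxr0 := occ_index_gt0 r.
have idxqc : (occ_index xi q <= occ_count xi (xi p))%N.
  by rewrite -xq occ_index_le_count.
have idxrc : (occ_index xi r <= occ_count xi (xi p))%N.
  by rewrite -xr occ_index_le_count.
have idxpc := occ_index_le_count p.
have rq := occ_index_lt (esym xqr); have qp := occ_index_lt xq.
have rp := occ_index_lt xr; have pr := occ_index_lt (esym xr).
apply/negP; case: (ltnP r p) => [ltrp /andP[ltrq ltqp]|lepr ltq].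
  by move: idxr (rq ltrq) (qp ltqp) (rp ltrp); case: eqP => _; lia.
move: idxr; case: eqP => idx1 idxr.
  by case/orP: ltq => [/rq|/qp]; lia.
have [eqpr|/pr] : (p : nat) = r \/ (p < r)%N by lia.
  have {}eqpr : p = r by apply: val_inj.
  by move: idxr; rewrite -eqpr; have := occ_index_gt0 p; lia.
by have := occ_index_gt0 p; lia.
Qed.

Lemma val_ord_sub (q s : 'I_n.+1) :
  nat_of_ord (q - s)%R = (if s <= q then q - s else q + n.+1 - s)%N.
Proof.
have := ltn_ord q; have := ltn_ord s; rewrite /= modnDmr => ltsn ltqn.
case: leqP => leqsq.
  by rewrite (_ : q + (n.+1 - s) = (q - s) + n.+1)%N ?modnDr ?modn_small; lia.
by rewrite addnBA ?modn_small; lia.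
Qed.

(** Without modular arithmetic, a sub-cycle is an interval of positions, or the
    complement of one when it runs through the end of the cycle. *)
Lemma in_subcycle p q :
  (q \in subcycle xi p) =
  (if prev_occ xi p < p then prev_occ xi p < q <= p
   else (prev_occ xi p < q) || (q <= p))%N.
Proof.
rewrite inE !val_ord_sub /=; set r := prev_occ xi p.
have := ltn_ord q; have := ltn_ord r; have := ltn_ord p => ltp ltr ltq.
have [rn|rn] := eqVneq (r : nat) n.
  by rewrite rn modnn !leq0n !subn0; case: ltnP; lia.
rewrite modn_small; last by lia.
by do 3 case: ltnP => ?; lia.
Qed.

Lemma subcycle_self p : p \in subcycle xi p.
Proof. by rewrite inE leqnn. Qed.

End PreviousVisit.

Section VisitIndices.
Context (V : finType) (n : nat) (xi : 'I_n.+1 -> V).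
Implicit Types p q : 'I_n.+1.

Lemma inZp_tour k p : inZp (k * n.+1 + p) = p :> 'I_n.+1.
Proof. by apply: val_inj; rewrite /= modnMDl modn_small. Qed.

Lemma visited_tour k p : visited xi (k * n.+1 + p) = xi p.
Proof. by rewrite /visited inZp_tour. Qed.

(** The sub-cycle of the position of visit [m], traced backwards in the endless
    sequence of visits.  The value is meaningful only for [n < m]: the targets
    visited in the first tour need not have been visited before. *)
Definition prev_visit (m : nat) : nat :=
  let p : 'I_n.+1 := inZp m in let r := prev_occ xi p in
  ((if r < p then m %/ n.+1 else (m %/ n.+1).-1) * n.+1 + r)%N.

Lemma prev_visit_tour k p : prev_visit (k.+1 * n.+1 + p) =
  ((if prev_occ xi p < p then k.+1 else k) * n.+1 + prev_occ xi p)%N.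
Proof. by rewrite /prev_visit inZp_tour divnMDl// divn_small ?ltn_ord// addn0. Qed.

Lemma tour_position m : (n < m)%N -> exists k p, m = (k.+1 * n.+1 + p)%N.
Proof.
move=> nm; exists (m %/ n.+1).-1, (inZp m); rewrite prednK ?divn_gt0//=.
exact: divn_eq.
Qed.

Lemma visited_prev m : (n < m)%N -> visited xi (prev_visit m) = visited xi m.
Proof.
case/tour_position => k [p ->].
by rewrite prev_visit_tour !visited_tour xi_prev_occ.
Qed.

Lemma prev_visit_lt m : (n < m)%N -> (prev_visit m < m)%N.
Proof.
case/tour_position => k [p ->]; rewrite prev_visit_tour.
have := ltn_ord (prev_occ xi p).
by case: (ltnP _ p) => rp ltr; rewrite ?ltn_add2l// mulSn; lia.
Qed.

(** With [visited_prev] and [prev_visit_lt], this makes [prev_visit m] the most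
    recent visit to the target of visit [m]. *)
Lemma no_visit_between m l : (n < m)%N -> (prev_visit m < l < m)%N ->
  visited xi l <> visited xi m.
Proof.
case/tour_position => k [p ->]; rewrite prev_visit_tour visited_tour.
move=> lm xl; pose q : 'I_n.+1 := inZp l.
have lE : l = (l %/ n.+1 * n.+1 + q)%N by apply: divn_eq.
have {xl}/no_visit_after_prev : xi q = xi p by rewrite -xl lE visited_tour.
move: (ltn_ord q) (ltn_ord p) (ltn_ord (prev_occ xi p)) lm; rewrite lE.
move: (l %/ n.+1)%N => j; rewrite mulSn; case: (ltnP _ p) => rp ltq ltp ltr /andP[lo hi].
  have jE : j = k.+1 by nia.
  by move: lo hi; rewrite jE; lia.
have : j = k \/ j = k.+1 by nia.
by case=> jE; move: lo hi; rewrite jE; lia.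
Qed.

Section Telescoping.
Context (R : zmodType).

Lemma sum_ord_telescope (Phi : nat -> R) (a b : nat) : (a <= b)%N -> (b <= n.+1)%N ->
  \sum_(q < n.+1 | (a <= q < b)%N) (Phi q.+1 - Phi q) = Phi b - Phi a.
Proof.
move=> ab bn; rewrite -(telescope_sumr Phi ab) big_geq_mkord.
rewrite (big_ord_widen_cond _ (fun i => a <= i)%N (fun i => Phi i.+1 - Phi i) bn).
exact: eq_bigl.
Qed.

(** The visits after [prev_visit m] and up to [m] are the elements of the
    sub-cycle of [p], each in its most recent tour; this is how the sums in
    [dwell_step] arise as elapsed times. *)
Lemma subcycle_telescope (Phi : nat -> R) k p :
  let m := (k.+1 * n.+1 + p)%N in
  Phi m - Phi (prev_visit m) =
    \sum_(q in subcycle xi p | (q <= p)%N)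
      (Phi (k.+1 * n.+1 + q)%N - Phi (k.+1 * n.+1 + q).-1%N)
  + \sum_(q in subcycle xi p | (p < q)%N)
      (Phi (k * n.+1 + q)%N - Phi (k * n.+1 + q).-1%N).
Proof.
rewrite /= prev_visit_tour.
have := ltn_ord (prev_occ xi p); have := ltn_ord p; set r := prev_occ xi p => ltp ltr.
have shift (j q : nat) :
    Phi (j * n.+1 + q)%N - Phi (j * n.+1 + q).-1%N =
    Phi ((j * n.+1 + q.+1).-1)%N - Phi (j * n.+1 + q).-1%N.
  by rewrite addnS.
case: (ltnP r p) => rp.
  rewrite [X in _ = _ + X]big_pred0 ?addr0; last first.
    by move=> q; rewrite in_subcycle -/r rp; lia.
  rewrite (eq_bigr _ (fun (q : 'I_n.+1) _ => shift k.+1 q)).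
  rewrite (eq_bigl (fun q : 'I_n.+1 => r.+1 <= q < p.+1)%N); last first.
    by move=> q; rewrite in_subcycle -/r rp; lia.
  rewrite (@sum_ord_telescope (fun i => Phi (k.+1 * n.+1 + i).-1%N)); last 2 first.
  - by rewrite ltnS ltnW.
  - exact: ltn_ord.
  by rewrite !addnS.
rewrite (eq_bigr _ (fun (q : 'I_n.+1) _ => shift k.+1 q)).
rewrite (eq_bigl (fun q : 'I_n.+1 => 0 <= q < p.+1)%N); last first.
  by move=> q; rewrite in_subcycle -/r ltnNge rp/=; lia.
rewrite (@sum_ord_telescope (fun i => Phi (k.+1 * n.+1 + i).-1%N)) //.
rewrite [X in _ = _ + X](eq_bigr _ (fun (q : 'I_n.+1) _ => shift k q)).
rewrite (eq_bigl (fun q : 'I_n.+1 => r.+1 <= q < n.+1)%N); last first.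
  by move=> q; rewrite in_subcycle -/r ltnNge rp/=; have := ltn_ord q; lia.
rewrite (@sum_ord_telescope (fun i => Phi (k * n.+1 + i).-1%N)) //.
by rewrite addn0 mulSn [(n.+1 + _)%N]addnC !addnS /= addrA subrK.
Qed.

(** The stretches between consecutive visits to [i] tile the one from [l0] to
    [l1], as no visit to [i] falls strictly inside a stretch. *)
Lemma visits_telescope (Phi : nat -> R) (i : V) l0 l1 :
  (n < l0)%N -> (l0 <= l1)%N -> visited xi l0 = i -> visited xi l1 = i ->
  \sum_(l0 <= l < l1 | visited xi l.+1 == i) (Phi l.+1 - Phi (prev_visit l.+1)) =
  Phi l1 - Phi l0.
Proof.
move=> nl0 + vl0; elim/ltn_ind: l1 => l1 IH.
rewrite leq_eqVlt => /predU1P[<- _|l01 vl1]; first by rewrite big_geq// subrr.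
have nl1 : (n < l1)%N by lia.
have pl1 := prev_visit_lt nl1.
have l0p : (l0 <= prev_visit l1)%N.
  rewrite leqNgt; apply/negP => pl0.
  have /(no_visit_between nl1) : (prev_visit l1 < l0 < l1)%N by rewrite pl0.
  by rewrite vl0 vl1.
rewrite (@big_cat_nat _ _ _ (prev_visit l1)) //=; last exact: ltnW.
rewrite IH //; last by rewrite visited_prev.
case: l1 => // l1 in nl1 pl1 {IH l01 l0p} vl1 *.
rewrite big_mkcond big_nat_recr //= vl1 eqxx big_nat big1 ?add0r.
  by rewrite addrC addrA subrK.
move=> l lm; case: eqP => // vl.
by case: (@no_visit_between l1.+1 l.+1) => //; rewrite ?vl ?vl1//; lia.
Qed.

End Telescoping.
End VisitIndices.

(** * Functions of constant slope and their integrals *)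

Section Analysis.
Context (R : realType).
Notation mu := (@lebesgue_measure R).

(** The derivative is only assumed in the open segment, since uncertainties have
    corners at arrivals and departures; continuity and the mean value theorem
    give the values at the end points. *)
Lemma affine_of_constant_derivative (f : R -> R) (a b c : R) :
  {within `[a, b], continuous f} ->
  (forall t, a < t < b -> is_derive t (1 : R) f c) ->
  forall t, a <= t <= b -> f t = f a + c * (t - a).
Proof.
move=> cf df t /andP[at_ tb].
have [||_ _ fta] := @MVT_segment R f (fun=> c) a t at_; last by rewrite -fta subrKC.
- move=> x; rewrite in_itv/= => /andP[ax xt].
  by apply: df; rewrite ax (lt_le_trans xt).
- by apply: continuous_subspaceW cf; apply: subset_itvl; rewrite bnd_simp.
Qed.

Lemma Rintegral_affine (f : R -> R) (a b c : R) : a <= b ->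
  (forall t, a <= t <= b -> f t = f a + c * (t - a)) ->
  \int[mu]_(t in `[a, b]) f t = (b - a) * (f a + f b) / 2.
Proof.
rewrite le_eqVlt => /predU1P[<- _|ab fE].
  by rewrite set_itv1 Rintegral_set1 subrr !mul0r.
rewrite (@eq_Rintegral _ _ _ mu _ (fun t => f a + c * (t - a))); last first.
  by move=> t; rewrite inE/= in_itv/= => /fE.
pose F t := f a * t + c / 2 * (t - a) ^+ 2.
have cF : continuous F.
  move=> x; apply: cvgD; apply: cvgM; try exact: cvg_cst; first exact: cvg_id.
  by apply: cvgM; apply: cvgB; try exact: cvg_cst; exact: cvg_id.
have dF (x : R) : is_derive x (1 : R) F (f a + c * (x - a)).
  by apply: is_derive_eq; rewrite /GRing.scale/=; field.
have -> : \int[mu]_(t in `[a, b]) (f a + c * (t - a)) = F b - F a.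
  rewrite /Rintegral; set g := (fun t : R => f a + c * (t - a)).
  have /= -> // := @continuous_FTC2 R g F a b ab.
  - apply: continuous_subspaceT => x; apply: cvgD; first exact: cvg_cst.
    by apply: cvgM; [exact: cvg_cst|apply: cvgB; [exact: cvg_id|exact: cvg_cst]].
  - split; first by move=> x _; have [] := dF x.
      by apply: cvg_at_right_filter; exact: cF.
    by apply: cvg_at_left_filter; exact: cF.
  - by move=> x _; rewrite derive1E; have [_] := dF x.
rewrite (fE b); last by rewrite lexx ltW.
by rewrite /F; field.
Qed.

Section Primitive.
Variable f : R -> R.
Hypothesis cf : {within `[0, +oo[, continuous f}.

Lemma within_segment a b : 0 <= a -> {within `[a, b], continuous f}.
Proof.
move=> a0; apply: continuous_subspaceW cf => t /=.
by rewrite !in_itv/= andbT => /andP[at_ _]; exact: le_trans at_.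
Qed.

Lemma segment_integrable a b : 0 <= a -> mu.-integrable `[a, b] (EFin \o f).
Proof.
move=> a0; apply: continuous_compact_integrable; first exact: segment_compact.
exact: within_segment.
Qed.

Definition primitive (S : R) : R := \int[mu]_(t in `[0, S]) f t.

Lemma primitiveB a b : 0 <= a <= b ->
  primitive b - primitive a = \int[mu]_(t in `[a, b]) f t.
Proof.
move=> /andP[a0 ab].
rewrite /primitive Rintegral_itvB; last 3 first.
- exact: segment_integrable.
- by rewrite bnd_simp.
- by rewrite bnd_simp.
rewrite Rintegral_itv_obnd_cbnd//.
apply: (@integrableS _ _ _ mu `[a, b]) => //; last exact: segment_integrable.
by apply: subset_itvr; rewrite bnd_simp.
Qed.

Lemma primitive_homo : (forall t, 0 <= t -> 0 <= f t) ->
  forall a b, 0 <= a <= b -> primitive a <= primitive b.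
Proof.
move=> f0 a b /andP[a0 ab]; rewrite -subr_ge0 primitiveB ?a0//.
apply: Rintegral_ge0 => t /=; rewrite in_itv/= => /andP[at_ _].
by apply: f0; exact: le_trans at_.
Qed.

(** Trapezium rule, exact on a segment where the slope of [f] is constant. *)
Lemma primitive_constant_derivative (a b c : R) : 0 <= a <= b ->
  (forall t, a < t < b -> is_derive t (1 : R) f c) ->
  f b = f a + c * (b - a) /\
  primitive b - primitive a = (b - a) * (f a + f b) / 2.
Proof.
move=> /andP[a0 ab] df.
have fE := affine_of_constant_derivative (within_segment a0) df.
split; first by apply: fE; rewrite ab lexx.
by rewrite primitiveB ?a0// (Rintegral_affine ab fE).
Qed.

End Primitive.

Lemma Rintegral_sum_within (I : finType) (P : pred I) (f : I -> R -> R) (S : R) :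
  (forall i, {within `[0, +oo[, continuous (f i)}) ->
  \int[mu]_(t in `[0, S]) (\sum_(i | P i) f i t) = \sum_(i | P i) primitive (f i) S.
Proof.
move=> cf; have int_f i : mu.-integrable `[0, S] (EFin \o f i).
  exact: segment_integrable.
elim: (index_enum I) => [|i r IH].
  under eq_Rintegral do rewrite big_nil.
  by rewrite big_nil Rintegral_cst// mul0r.
under eq_Rintegral do rewrite big_cons.
rewrite big_cons; case: (P i) => //; rewrite RintegralD ?IH//.
rewrite (_ : _ \o _ = fun t => (\sum_(j <- r | P j) (EFin \o f j) t)%E).
  exact: integrable_sum.
by apply/funext => t /=; rewrite sumEFin.
Qed.

End Analysis.

(** * Means along sampling times *)

Section WeightedCesaro.
Context (R : realType).

(** A Stolz-Cesaro lemma: the asymptotic slope of a nondecreasing [G] can be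
    read off along any sequence of sampling times whose steps stay bounded. *)
Lemma mean_of_slopes (G : R -> R) (s : nat -> R) (c D : R) :
  (forall a b, 0 <= a <= b -> G a <= G b) ->
  (forall k, 0 <= s k) -> (forall k, s k <= s k.+1) ->
  s k @[k --> \oo] --> +oo ->
  s k.+1 - s k @[k --> \oo] --> D ->
  (forall e, 0 < e -> \forall k \near \oo,
     `|G (s k.+1) - G (s k) - c * (s k.+1 - s k)| <= e * (s k.+1 - s k)) ->
  S^-1 * G S @[S --> +oo] --> c.
Proof.
move=> Ghomo s0 smono soo stepD slope; apply/cvgrPdistC_le => e e0.
have e2 : 0 < e / 2 by rewrite divr_gt0.
have [N _ HN] : \forall k \near \oo,
    `|G (s k.+1) - G (s k) - c * (s k.+1 - s k)| <= e / 2 * (s k.+1 - s k) /\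
    `|(s k.+1 - s k) - D| <= 1.
  near=> k; split; near: k; first exact: slope.
  by move/cvgrPdistC_le : stepD; apply.
(* [M] bounds the sampling steps and [C] gathers the errors that do not grow
   with [S], due to the start at [s N] and to the last incomplete step. *)
pose M := D + 1.
have step j : s (N + j).+1 <= s (N + j)%N + M.
  have [_] := HN (N + j)%N (leq_addr _ _); rewrite ler_norml /M => /andP[_]; lra.
have slopes j : `|G (s (N + j)%N) - G (s N) - c * (s (N + j)%N - s N)|
    <= e / 2 * (s (N + j)%N - s N).
  elim: j => [|j]; first by rewrite addn0 !subrr !mulr0 subrr normr0.
  have [+ _] := HN (N + j)%N (leq_addr _ _); rewrite addnS !ler_norml.
  by move=> /andP[? ?] /andP[? ?]; apply/andP; split; lra.
pose C := `|G (s N)| + `|c| * (M + s N) + e / 2 * M.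
near=> S.
have S0 : 0 < S by near: S; exact: nbhs_pinfty_gt.
have SN : s N <= S by near: S; by apply: nbhs_pinfty_ge; exact: num_real.
have SC : C <= e / 2 * S.
  by rewrite -ler_pdivrMl//; near: S; apply: nbhs_pinfty_ge; exact: num_real.
have exS : exists j, S < s (N + j)%N.
  have [K _ HK] : \forall k \near \oo, S < s k by move/cvgryPgt : soo; apply.
  by exists K; apply: HK => /=; exact: leq_addl.
(* Monotonicity of [G] compares [G S] with its values at the two sampling times
   around [S]. *)
case: (ex_minnP exS) => -[|j] Sj minj; first by move: Sj; rewrite addn0 ltNge SN.
have jS : s (N + j)%N <= S.
  by rewrite leNgt; apply/negP => /minj; rewrite ltnn.
have sj0 := s0 (N + j)%N; have sN0 := s0 N.
have GjS : G (s (N + j)%N) <= G S by apply: Ghomo; rewrite sj0.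
have GSj : G S <= G (s (N + j.+1)%N) by apply: Ghomo; rewrite !ltW.
rewrite (_ : _ - c = (G S - c * S) / S); last by field; rewrite gt_eqF.
rewrite normrM normfV (gtr0_norm S0) ler_pdivrMr//.
have M0 : 0 <= M by have := step j; have := smono (N + j)%N; lra.
have stepj := step j; rewrite -addnS in stepj.
have bound x : 0 <= x <= M -> - (`|c| * M) <= c * x <= `|c| * M.
  move=> /andP[x0 xM]; rewrite -ler_norml normrM (ger0_norm x0).
  by apply: ler_wpM2l.
have /bound/andP[b1 b2] : 0 <= S - s (N + j)%N <= M by apply/andP; split; lra.
have /bound/andP[b3 b4] : 0 <= s (N + j.+1)%N - S <= M by apply/andP; split; lra.
have [b5 b6] : - (`|c| * s N) <= c * s N /\ c * s N <= `|c| * s N.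
  by apply/andP; rewrite -ler_norml normrM (ger0_norm sN0).
have [g1 g2] : - `|G (s N)| <= G (s N) /\ G (s N) <= `|G (s N)|.
  by apply/andP; rewrite -ler_norml.
move: (slopes j) (slopes j.+1) SC; rewrite /C !ler_norml.
have p1 : 0 <= e / 2 * (S - s (N + j)%N) by rewrite mulr_ge0// ?subr_ge0// ltW.
have p2 : 0 <= e / 2 * (S + M - s (N + j.+1)%N).
  by rewrite mulr_ge0// ?(ltW e2)//; lra.
have p3 : 0 <= e / 2 * s N by rewrite mulr_ge0// ltW.
have p4 : 0 <= e / 2 * M by rewrite mulr_ge0// ltW.
by move=> /andP[? ?] /andP[? ?] ?; apply/andP; split; lra.
Unshelve. all: by end_near.
Qed.

End WeightedCesaro.

(** * Uncertainty along a trajectory *)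

Section TrajectoryVisits.
Context (R : realType) (V : finType) (n : nat) (xi : 'I_n.+1 -> V).
Context (rho : V -> V -> R) (A B : V -> R).
Context (arr dep : nat -> R) (unc : V -> R -> R).
Hypothesis rho_ge0 : forall p, 0 <= rho (xi p) (xi (ordS p)).
Hypothesis A_gt0 : forall i, 0 < A i.
Hypothesis traj : leave_at_zero_trajectory xi rho A B arr dep unc.

Lemma visited_ordS k : visited xi k.+1 = xi (ordS (inZp k)).
Proof.
by rewrite /visited; congr xi; apply: val_inj; rewrite /= -addn1 -modnDml addn1.
Qed.

Lemma dep_le_arrS k : dep k <= arr k.+1.
Proof. by rewrite (traj_travel traj) lerDl visited_ordS; exact: rho_ge0. Qed.

Lemma arr_homo k l : (k <= l)%N -> arr k <= arr l.
Proof.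
have step j : arr j <= arr j.+1.
  exact: le_trans (traj_dwell traj j) (dep_le_arrS j).
exact: (@homo_leq _ arr (fun x y => x <= y) lexx le_trans step).
Qed.

Lemma dep_le_arr k l : (k < l)%N -> dep k <= arr l.
Proof. by move=> /arr_homo; exact: le_trans (dep_le_arrS k). Qed.

Lemma dep_homo k l : (k <= l)%N -> dep k <= dep l.
Proof.
rewrite leq_eqVlt => /predU1P[->//|/dep_le_arr kl].
exact: le_trans kl (traj_dwell traj l).
Qed.

Lemma arr_ge0 k : 0 <= arr k.
Proof. exact: le_trans (traj_start traj) (arr_homo (leq0n k)). Qed.

Lemma dep_ge0 k : 0 <= dep k.
Proof. exact: le_trans (arr_ge0 k) (traj_dwell traj k). Qed.

(** Until the departure the agent is present and the uncertainty nonzero, which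
    excludes the boundary case of the dynamics whatever the sign of [A - B]. *)
Lemma is_derive_dwelling m t : arr m < t < dep m ->
  is_derive t (1 : R) (unc (visited xi m)) (A (visited xi m) - B (visited xi m)).
Proof.
move=> /andP[mt tm]; set i := visited xi m.
have -> : A i - B i = uncertainty_rate (A i) (B i) (unc i t)
                        (agents_at xi arr dep i t).
  rewrite /uncertainty_rate (negbTE (traj_stay traj _)) ?(ltW mt)//=.
  rewrite /agents_at asboolT ?mulr1//.
  by exists m; split => //; rewrite !ltW.
apply: (traj_dynamics traj); first exact: le_lt_trans (arr_ge0 m) mt.
case=> k [_ tk]; have := traj_dwell traj k.
case: (ltngtP k m) tk => [/dep_le_arr|/dep_le_arr|->]; lra.
Qed.

(** No visit to the target meets the times between its consecutive visits, so
    the agent is absent and the boundary case of the dynamics cannot occur. *)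
Lemma is_derive_away m t : (n < m)%N -> dep (prev_visit xi m) < t < arr m ->
  is_derive t (1 : R) (unc (visited xi m)) (A (visited xi m)).
Proof.
move=> nm /andP[mt tm]; set i := visited xi m.
have away k : visited xi k = i -> ~ (arr k <= t <= dep k).
  move=> ki /andP[kt tk].
  have [/dep_homo|pk] := leqP k (prev_visit xi m); first by lra.
  have [/arr_homo|km] := leqP m k; first by lra.
  by apply: (@no_visit_between _ _ xi m k); rewrite ?pk.
have -> : A i = uncertainty_rate (A i) (B i) (unc i t)
                  (agents_at xi arr dep i t).
  rewrite /agents_at asboolF; last by case=> k [/away].
  by rewrite /uncertainty_rate !mulr0 leNgt A_gt0 andbF subr0.
apply: (traj_dynamics traj); first exact: le_lt_trans (dep_ge0 _) mt.
case=> k [/away + tk]; have := traj_dwell traj k.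
by case: tk => -> ? []; apply/andP; split.
Qed.

(** Between two consecutive departures from a target its uncertainty draws a
    triangle, of height [A] times the absence, which is also [B - A] times the
    dwell time because the uncertainty vanishes at both departures. *)
Lemma uncertainty_triangle m (i := visited xi m) : (n < m)%N ->
  (B i - A i) * (dep m - arr m) = A i * (arr m - dep (prev_visit xi m)) /\
  primitive (unc i) (dep m) - primitive (unc i) (dep (prev_visit xi m)) =
  (dep m - dep (prev_visit xi m)) * ((B i - A i) * (dep m - arr m) / 2).
Proof.
move=> nm; have ci : {within `[0, +oo[, continuous (unc i)}.
  exact: (@traj_continuous _ _ _ _ _ _ _ _ _ _ traj i).
have pm : dep (prev_visit xi m) <= arr m by exact/dep_le_arr/prev_visit_lt.
have up0 : 0 <= dep (prev_visit xi m) <= arr m by rewrite dep_ge0.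
have dn0 : 0 <= arr m <= dep m by rewrite arr_ge0 (traj_dwell traj).
have [up upG] := primitive_constant_derivative ci up0
  (fun t => @is_derive_away m t nm).
have [dn dnG] := primitive_constant_derivative ci dn0
  (fun t => @is_derive_dwelling m t).
have um := traj_leave traj m.
have up_ : unc i (dep (prev_visit xi m)) = 0.
  by rewrite /i -(visited_prev xi nm) (traj_leave traj).
rewrite -/i in um dn; rewrite um up up_ add0r in dn; split; first by lra.
rewrite -(subrK (primitive (unc i) (arr m)) (primitive (unc i) (dep m))).
rewrite -addrA upG dnG um up up_ !add0r addr0.
have -> : (B i - A i) * (dep m - arr m) = A i * (arr m - dep (prev_visit xi m)).
  by lra.
by field.
Qed.

Lemma dep_step j (q : 'I_n.+1) : (0 < j * n.+1 + q)%N ->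
  dep (j * n.+1 + q)%N - dep (j * n.+1 + q).-1%N =
  travel_vec xi rho q ord0 + tour_dwell n arr dep j q ord0.
Proof.
rewrite !mxE; move: (j * n.+1 + q)%N (esym (inZp_tour j q)) => [//|l] -> _.
rewrite /= (traj_travel traj) /visited.
suff -> : ord_pred (inZp l.+1 : 'I_n.+1) = inZp l by ring.
by apply: val_inj; rewrite /= addnS /= modnDml addSnnS modnDr.
Qed.

Lemma visit_period k (p : 'I_n.+1) (m := (k.+1 * n.+1 + p)%N) :
  dep m - dep (prev_visit xi m) =
    \sum_(q in subcycle xi p) travel_vec xi rho q ord0
  + \sum_(q in subcycle xi p | (q <= p)%N) tour_dwell n arr dep k.+1 q ord0
  + \sum_(q in subcycle xi p | (p < q)%N) tour_dwell n arr dep k q ord0.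
Proof.
rewrite subcycle_telescope.
rewrite (eq_bigr _ (fun (q : 'I_n.+1) _ => @dep_step k.+1 q isT)).
rewrite [X in _ + X = _](eq_bigr (fun q => travel_vec xi rho q ord0 +
  tour_dwell n arr dep k q ord0)); last first.
  by move=> q /andP[_ pq]; rewrite dep_step//; lia.
rewrite !big_split /= [X in _ = X + _ + _](bigID (fun q : 'I_n.+1 => (q <= p)%N)) /=.
have -> : \sum_(q in subcycle xi p | ~~ (q <= p)%N) travel_vec xi rho q ord0 =
          \sum_(q in subcycle xi p | (p < q)%N) travel_vec xi rho q ord0.
  by apply: eq_bigl => q; rewrite ltnNge.
by ring.
Qed.

(** Each entry of the recursion is the balance of one uncertainty triangle. *)
Lemma tour_dwell_orbit : orbit_of (dwell_step xi rho A B) (tour_dwell n arr dep).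
Proof.
move=> k p; have nm : (n < k.+1 * n.+1 + p)%N by rewrite mulSn; lia.
have [balance _] := uncertainty_triangle nm; rewrite visited_tour in balance.
have := visit_period k p; rewrite [X in _ = _ + X + _ -> _](bigD1 p) /=; last first.
  by rewrite subcycle_self leqnn.
rewrite (_ : tour_dwell _ _ _ k.+1 p ord0 = dep (k.+1 * n.+1 + p)%N
            - arr (k.+1 * n.+1 + p)%N); last by rewrite !mxE.
rewrite [X in _ = _ + (_ + X) + _ -> _](eq_bigl (fun q : 'I_n.+1 => (q \in subcycle xi p) && (q < p)%N)); last first.
  by move=> q; rewrite ltn_neqAle -andbA [(_ <= _)%N && _]andbC.
by move=> period; rewrite balance; congr (_ * _); lra.
Qed.

End TrajectoryVisits.

(** * The equilibrium dwell times *)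

Section Equilibrium.
Context (R : realType) (V : finType) (n : nat) (xi : 'I_n.+1 -> V).
Context (rho : V -> V -> R) (A B : V -> R).
Hypothesis A_gt0 : forall i, 0 < A i.
Implicit Types (p q : 'I_n.+1) (tau : 'cV[R]_n.+1).

Notation dwell_mx := (diag_mx (gamma_vec xi A B)^T - subcycle_mx R xi).

Lemma subcycle_mxE tau p :
  (subcycle_mx R xi *m tau) p ord0 = \sum_(q in subcycle xi p) tau q ord0.
Proof.
rewrite mxE [RHS]big_mkcond; apply: eq_bigr => q _; rewrite !mxE.
by case: (q \in _); rewrite ?mul1r ?mul0r.
Qed.

Lemma subcycle_timeE tau p : subcycle_time xi rho tau p =
  \sum_(q in subcycle xi p) (travel_vec xi rho q ord0 + tau q ord0).
Proof.
rewrite /subcycle_time mxE [RHS]big_mkcond; apply: eq_bigr => q _; rewrite !mxE.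
by case: (q \in _); rewrite ?mul1r ?mul0r.
Qed.

Lemma cycle_timeE tau : cycle_time xi rho tau =
  \sum_q (travel_vec xi rho q ord0 + tau q ord0).
Proof.
by rewrite /cycle_time mxE; apply: eq_bigr => q _; rewrite !mxE mul1r.
Qed.

Lemma dwell_mxE tau p : (dwell_mx *m tau) p ord0 =
  B (xi p) / A (xi p) * tau p ord0 - \sum_(q in subcycle xi p) tau q ord0.
Proof.
rewrite mulmxBl [LHS]mxE [X in _ + X = _]mxE subcycle_mxE mul_diag_mx.
by rewrite !mxE.
Qed.

Lemma subcycle_split (f : 'I_n.+1 -> R) p :
  \sum_(q in subcycle xi p) f q = f p
  + \sum_(q in subcycle xi p | (q < p)%N) f q
  + \sum_(q in subcycle xi p | (p < q)%N) f q.
Proof.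
rewrite (bigD1 p) ?subcycle_self//= -addrA; congr (_ + _).
rewrite (bigID (fun q : 'I_n.+1 => (q < p)%N)) /=.
by congr (_ + _); apply: eq_bigl => q; rewrite -andbA; congr (_ && _);
  rewrite -val_eqE/=; case: ltngtP.
Qed.

(** At an equilibrium both sums over dwell times in [dwell_step] use the same
    vector, and adding [A * tau p] to both sides completes the sub-cycle. *)
Lemma equilibriumP tau : dwell_step xi rho A B tau tau <->
  dwell_mx *m tau = subcycle_mx R xi *m travel_vec xi rho.
Proof.
have eqp p : (B (xi p) - A (xi p)) * tau p ord0 =
    A (xi p) * (\sum_(q in subcycle xi p) travel_vec xi rho q ord0
                + \sum_(q in subcycle xi p | (q < p)%N) tau q ord0
                + \sum_(q in subcycle xi p | (p < q)%N) tau q ord0) <->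
    (dwell_mx *m tau) p ord0 = (subcycle_mx R xi *m travel_vec xi rho) p ord0.
  have A0 : A (xi p) != 0 by rewrite gt_eqF.
  rewrite dwell_mxE subcycle_mxE (subcycle_split (fun q => tau q ord0)).
  set ST := \sum_(q in _) _; set S1 := \sum_(q in subcycle xi p | (q < p)%N) _.
  set S2 := \sum_(q in subcycle xi p | (p < q)%N) _.
  have -> : B (xi p) / A (xi p) * tau p ord0 - (tau p ord0 + S1 + S2) =
    ((B (xi p) - A (xi p)) * tau p ord0 - A (xi p) * (S1 + S2)) / A (xi p).
    by field.
  split=> [->|eqST]; first by field.
  by rewrite -eqST; field.
by split=> [st|/matrixP eqm p]; [apply/matrixP => p j; rewrite ord1|]; apply/eqp.
Qed.

(** A kernel vector could be added to the equilibrium to give another one, whose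
    constant orbit would not be attracted to the first. *)
Lemma dwell_mx_unit tau : dwell_step xi rho A B tau tau ->
  globally_attractive (dwell_step xi rho A B) tau -> dwell_mx \in unitmx.
Proof.
move=> eqtau attr; apply/negPn/negP; rewrite -unitmx_tr -row_free_unit -kermx_eq0.
case/rowV0Pn => v /sub_kermxP vM v0.
have Mv : dwell_mx *m v^T = 0 by rewrite -[LHS]trmxK trmx_mul trmxK vM trmx0.
have eqtv : dwell_step xi rho A B (tau + v^T) (tau + v^T).
  by apply/equilibriumP; rewrite mulmxDr Mv addr0; apply/equilibriumP.
have /= cvg_tau := attr (fun=> tau + v^T) (fun=> eqtv).
have /eqP : tau + v^T = tau.
  exact: cvg_unique (@norm_hausdorff _ _) _ _ _ _ (cvg_cst _) cvg_tau.
by rewrite -subr_eq0 addrAC subrr add0r trmx_eq0 (negbTE v0).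
Qed.

Lemma equilibrium_steady tau : dwell_step xi rho A B tau tau ->
  dwell_mx \in unitmx -> tau = steady_dwell xi rho A B.
Proof.
by move=> /equilibriumP eqtau Mu; rewrite /steady_dwell -mulmxA -eqtau mulKmx.
Qed.

Hypothesis rho_ge0 : forall p, 0 <= rho (xi p) (xi (ordS p)).

Lemma travel_vec_ge0 p : 0 <= travel_vec xi rho p ord0.
Proof. by rewrite mxE -[X in rho _ (xi X)](ord_predK p). Qed.

Lemma le_cycle_time tau p : (forall q, 0 <= tau q ord0) ->
  tau p ord0 <= cycle_time xi rho tau.
Proof.
move=> tau0; rewrite cycle_timeE (bigD1 p)//=.
have tr0 := travel_vec_ge0 p.
have : 0 <= \sum_(q | q != p) (travel_vec xi rho q ord0 + tau q ord0).
  by apply: sumr_ge0 => q _; rewrite addr_ge0// travel_vec_ge0.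
lra.
Qed.

(** The degenerate case, where visit [p] fills the whole cycle, is an
    equilibrium only if the height [(B - A) * tau] of its triangle is zero. *)
Lemma triangle_height0 tau p : dwell_step xi rho A B tau tau ->
  (forall q, 0 <= tau q ord0) -> cycle_time xi rho tau = tau p ord0 ->
  (B (xi p) - A (xi p)) * tau p ord0 = 0.
Proof.
move=> eqtau tau0 cyc; rewrite eqtau.
suff [z1 z2] : (forall q, travel_vec xi rho q ord0 = 0) /\
    (forall q, q != p -> tau q ord0 = 0).
  rewrite !big1 ?addr0 ?mulr0// => q; rewrite ?z1// => /andP[_ pq];
  by apply: z2; rewrite -val_eqE/=; lia.
move: cyc; rewrite cycle_timeE big_split /= [X in _ + X = _](bigD1 p)//=.
have tr0 := travel_vec_ge0.
have S1 : 0 <= \sum_q travel_vec xi rho q ord0 by apply: sumr_ge0.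
have S2 : 0 <= \sum_(q | q != p) tau q ord0 by apply: sumr_ge0.
move=> cyc; split=> q.
  have /eqP : \sum_q travel_vec xi rho q ord0 = 0 by lra.
  by rewrite psumr_eq0// => /allP/(_ q (mem_index_enum _))/eqP.
move=> qp; have /eqP : \sum_(q | q != p) tau q ord0 = 0 by lra.
by rewrite psumr_eq0// => /allP/(_ q (mem_index_enum _)); rewrite qp => /eqP.
Qed.

(** The entry of [B_vec - A_vec] simplifies to [T_p (B - A) / T] unless [T] or
    [T - tau p] is zero; then the height of the triangle is zero as well. *)
Lemma mean_uncertainty_entry tau p : dwell_step xi rho A B tau tau ->
  (forall q, 0 <= tau q ord0) ->
  (B_vec xi rho A B tau - A_vec xi rho A B tau) p ord0 * tau p ord0 =
  subcycle_time xi rho tau p * ((B (xi p) - A (xi p)) * tau p ord0)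
    / cycle_time xi rho tau.
Proof.
move=> eqtau tau0; rewrite !mxE.
set b := B (xi p) - A (xi p); set T := cycle_time _ _ _.
set t := tau p ord0; set s := subcycle_time _ _ _ _.
have [bt0|bt0] := eqVneq (b * t) 0.
  rewrite bt0 mulr0 mul0r (_ : _ * t = (s / (T - t) - s / T * t / (T - t)) * (b * t)).
    by rewrite bt0 mulr0.
  by ring.
have Tt : T - t != 0.
  by rewrite subr_eq0; apply: contraNneq bt0 => /triangle_height0 ->.
have T0 : T != 0.
  apply: contraNneq bt0 => T0; have := le_cycle_time p tau0.
  rewrite -/T -/t T0 => t0; suff -> : t = 0 by rewrite mulr0.
  by apply/eqP; rewrite eq_le t0; exact: tau0.
by field; rewrite T0.
Qed.

End Equilibrium.

(** * Limits along tours *)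

Section TourwiseLimits.
Context (R : realType) (n : nat).
Implicit Types (X Y : nat -> R) (x y : 'I_n.+1 -> R).

(** The first tour is skipped, as its visits may have no predecessor. *)
Definition tourwise_cvg X x :=
  forall p : 'I_n.+1, X (k.+1 * n.+1 + p)%N @[k --> \oo] --> x p.

Lemma tourwise_cvg_at X x c : tourwise_cvg X x ->
  X (k.+1 * n.+1 + c)%N @[k --> \oo] --> x (inZp c).
Proof.
move=> /(_ (inZp c)); rewrite -(@cvg_shiftn (c %/ n.+1)) /=.
apply: cvg_trans; apply: near_eq_cvg; apply: nearW => k /=; congr X.
by rewrite [in RHS](divn_eq c n.+1) !mulSn mulnDl; lia.
Qed.

Lemma tourwise_cvgM X Y x y : tourwise_cvg X x -> tourwise_cvg Y y ->
  tourwise_cvg (fun l => X l * Y l) (fun p => x p * y p).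
Proof. by move=> Xx Yy p; apply: cvgM; [exact: Xx|exact: Yy]. Qed.

(** A window of [n + 1] consecutive visits meets each position once, wherever it
    starts. *)
Lemma tourwise_cvg_window X x (P : pred 'I_n.+1) (p0 : nat) : tourwise_cvg X x ->
  \sum_(k.+1 * n.+1 + p0 <= l < k.+1 * n.+1 + p0 + n.+1 | P (inZp l.+1)) X l.+1
    @[k --> \oo] --> \sum_(p | P p) x p.
Proof.
move=> Xx; pose h (q : 'I_n.+1) : 'I_n.+1 := inZp p0.+1 + q.
have hE (q : 'I_n.+1) : inZp (p0 + q).+1 = h q :> 'I_n.+1.
  by apply: val_inj; rewrite /= modnDml addSn.
rewrite (reindex_inj (addrI (inZp p0.+1 : 'I_n.+1))) /=.
rewrite (_ : (fun k => _) = (fun k =>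
    \sum_(q | P (h q)) X (k.+1 * n.+1 + (p0 + q).+1)%N)); last first.
  apply/funext => k; rewrite -[X in index_iota X _]add0n big_addn addKn big_mkord.
  apply: eq_big => q; rewrite ?hE; last by move=> _; rewrite addnC; congr X; lia.
  by rewrite addnC; congr (P _); rewrite -hE; apply: val_inj;
    rewrite /= -addnS -addnA modnMDl addnS.
apply: cvg_big => [|q _]; last by rewrite -/(h q) -hE; exact: tourwise_cvg_at.
exact: add_continuous.
Qed.

End TourwiseLimits.

(** * The steady state mean uncertainty *)

Section SteadyState.
Context (R : realType) (V : finType) (n : nat) (xi : 'I_n.+1 -> V).
Context (rho : V -> V -> R) (A B : V -> R).
Context (arr dep : nat -> R) (unc : V -> R -> R) (tau : 'cV[R]_n.+1).
Hypothesis rho_ge0 : forall p, 0 <= rho (xi p) (xi (ordS p)).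
Hypothesis A_gt0 : forall i, 0 < A i.
Hypothesis traj : leave_at_zero_trajectory xi rho A B arr dep unc.
Hypothesis tau_ge0 : forall p, 0 <= tau p ord0.
Hypothesis tau_cvg : tour_dwell n arr dep k @[k --> \oo] --> tau.

Notation T := (cycle_time xi rho tau).

Lemma tour_dwell_cvg p : tour_dwell n arr dep k p ord0 @[k --> \oo] --> tau p ord0.
Proof. exact: (cvg_comp _ _ tau_cvg (@coord_continuous _ _ _ p ord0 tau)). Qed.

Lemma tour_dwell_cvgS p :
  tour_dwell n arr dep k.+1 p ord0 @[k --> \oo] --> tau p ord0.
Proof.
have := @tour_dwell_cvg p.
by rewrite -(@cvg_shiftS _ (fun k => tour_dwell n arr dep k p ord0)).
Qed.

Lemma dwell_cvg : tourwise_cvg (fun l => dep l - arr l) (fun p => tau p ord0).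
Proof.
move=> p; have := @tour_dwell_cvgS p; apply: cvg_trans; apply: near_eq_cvg.
by apply: nearW => k; rewrite mxE.
Qed.

Lemma dep_step_cvg : tourwise_cvg (fun l => dep l - dep l.-1)
  (fun p => travel_vec xi rho p ord0 + tau p ord0).
Proof.
move=> p; rewrite (_ : (fun k => _) = (fun k => travel_vec xi rho p ord0 +
    tour_dwell n arr dep k.+1 p ord0)).
  by apply: cvgD; [exact: cvg_cst|exact: tour_dwell_cvgS].
by apply/funext => k; rewrite (dep_step traj).
Qed.

Lemma period_cvg : tourwise_cvg (fun l => dep l - dep (prev_visit xi l))
  (subcycle_time xi rho tau).
Proof.
move=> p; under eq_fun do rewrite (visit_period traj).
rewrite subcycle_timeE big_split /=.
rewrite [X in _ + X](bigID (fun q : 'I_n.+1 => (q <= p)%N)) /= addrA.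
have -> : \sum_(q in subcycle xi p | ~~ (q <= p)%N) tau q ord0 =
          \sum_(q in subcycle xi p | (p < q)%N) tau q ord0.
  by apply: eq_bigl => q; rewrite ltnNge.
apply: cvgD; first apply: cvgD; first exact: cvg_cst.
  apply: cvg_big => [|q _]; first exact: add_continuous.
  exact: tour_dwell_cvgS.
apply: cvg_big => [|q _]; first exact: add_continuous.
exact: tour_dwell_cvg.
Qed.

Section Target.
Variables (i : V) (p0 : 'I_n.+1).
Hypothesis xip0 : xi p0 = i.

Let m k := (k.+1 * n.+1 + p0)%N.
Let period l := dep l - dep (prev_visit xi l).
Let height l := (B (visited xi l) - A (visited xi l)) * (dep l - arr l) / 2.

Let n_lt_m k : (n < m k)%N. Proof. by rewrite /m mulSn; lia. Qed.

Let mS k : m k.+1 = (m k + n.+1)%N. Proof. by rewrite /m [in LHS]mulSn; lia. Qed.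

Lemma visits_window (Phi : nat -> R) k :
  Phi (m k.+1) - Phi (m k) = \sum_(m k <= l < m k + n.+1 | xi (inZp l.+1) == i)
    (Phi l.+1 - Phi (prev_visit xi l.+1)).
Proof.
by rewrite -mS (@visits_telescope _ _ xi _ Phi i)// ?mS ?leq_addr// -?mS
  /m visited_tour.
Qed.

Lemma integral_window k :
  primitive (unc i) (dep (m k.+1)) - primitive (unc i) (dep (m k)) =
  \sum_(m k <= l < m k + n.+1 | xi (inZp l.+1) == i) period l.+1 * height l.+1.
Proof.
rewrite (visits_window (fun l => primitive (unc i) (dep l))).
rewrite big_nat_cond [RHS]big_nat_cond; apply: eq_bigr => l /andP[/andP[ml _] /eqP li].
have nl : (n < l.+1)%N by have := n_lt_m k; lia.
have [_] := uncertainty_triangle rho_ge0 A_gt0 traj nl.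
by rewrite /= {1 2}/visited li.
Qed.

Lemma height_cvg :
  tourwise_cvg height (fun p => (B (xi p) - A (xi p)) * tau p ord0 / 2).
Proof.
move=> p; rewrite /height; under eq_fun do rewrite visited_tour.
apply: cvgM; last exact: cvg_cst.
by apply: cvgM; [exact: cvg_cst|exact: dwell_cvg].
Qed.

Lemma integral_step_cvg :
  primitive (unc i) (dep (m k.+1)) - primitive (unc i) (dep (m k)) @[k --> \oo]
  --> \sum_(p | xi p == i) subcycle_time xi rho tau p *
        ((B (xi p) - A (xi p)) * tau p ord0 / 2).
Proof.
under eq_fun do rewrite integral_window.
apply: (@tourwise_cvg_window R n _ _ (fun p => xi p == i) p0
  (tourwise_cvgM period_cvg height_cvg)).
Qed.

Lemma time_step_cvg : dep (m k.+1) - dep (m k) @[k --> \oo] --> T.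
Proof.
rewrite cycle_timeE; have := @tourwise_cvg_window R n _ _ predT p0 dep_step_cvg.
apply: cvg_trans; apply: near_eq_cvg; apply: nearW => k.
by rewrite telescope_sumr ?leq_addr// mS.
Qed.

(** When the cycle takes no time in the limit there is no period to average
    over, but then the heights of all triangles tend to zero. *)
Lemma slope_degenerate e : T = 0 -> 0 < e -> \forall k \near \oo,
  `|primitive (unc i) (dep (m k.+1)) - primitive (unc i) (dep (m k))|
    <= e * (dep (m k.+1) - dep (m k)).
Proof.
move=> T0 e0; have tau0 p : tau p ord0 = 0.
  by apply/eqP; rewrite eq_le tau_ge0 -T0 le_cycle_time.
have nheight : tourwise_cvg (fun l => `|height l|) (fun p : 'I_n.+1 => 0).
  move=> p; have h0 := @height_cvg p.
  rewrite /= tau0 mulr0 mul0r in h0.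
  by move/cvg_norm : h0; rewrite normr0; apply.
have := @tourwise_cvg_window R n _ _ (fun p => xi p == i) p0 nheight.
rewrite big1// => /cvgrPdistC_le/(_ e e0); apply: filterS => k.
rewrite subr0 ger0_norm ?sumr_ge0// => sum_e.
rewrite integral_window (visits_window dep) (le_trans (ler_norm_sum _ _ _))//.
rewrite mulr_sumr big_nat_cond [leRHS]big_nat_cond; apply: ler_sum.
move=> l /andP[/andP[ml lm] li]; rewrite normrM mulrC.
have nl : (n < l.+1)%N by have := n_lt_m k; lia.
have d0 : 0 <= period l.+1.
  by rewrite subr_ge0 (dep_homo rho_ge0 traj)// ltnW// prev_visit_lt.
rewrite (ger0_norm d0) ler_wpM2r// (le_trans _ sum_e)//.
rewrite (big_rem l) ?mem_index_iota ?ml//= li lerDl; exact: sumr_ge0.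
Qed.

(** Stated separately from [time_step_cvg], which does not imply it when the
    steps tend to zero. *)
Lemma dep_tour_cvg : dep (m k) @[k --> \oo] --> +oo.
Proof.
apply: ger_cvgy (traj_forever traj); apply: nearW => k.
apply: le_trans (traj_dwell traj k) _.
by apply: (dep_homo rho_ge0 traj); rewrite /m mulSn mulnS; lia.
Qed.

(** The sampling times are the departures from one fixed occurrence [p0] of the
    target, between which each of its triangles occurs once per tour. *)
Lemma target_mean_cvg : S^-1 * primitive (unc i) S @[S --> +oo] -->
  (\sum_(p | xi p == i) subcycle_time xi rho tau p *
     ((B (xi p) - A (xi p)) * tau p ord0 / 2)) / T.
Proof.
have step0 k : dep (m k) <= dep (m k.+1).
  by apply: (dep_homo rho_ge0 traj); rewrite mS leq_addr.
apply: (@mean_of_slopes _ _ (fun k => dep (m k)) _ T) => //.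
- apply: primitive_homo; last exact: traj_ge0 traj i.
  exact: (@traj_continuous _ _ _ _ _ _ _ _ _ _ traj i).
- by move=> k; exact: dep_ge0 rho_ge0 traj _.
- exact: dep_tour_cvg.
- exact: time_step_cvg.
move=> e e0; have [T0|T0] := eqVneq T 0.
  rewrite T0 invr0 mulr0; have := slope_degenerate T0 e0.
  by apply: filterS => k; rewrite mul0r subr0.
have Tgt0 : 0 < T.
  by rewrite lt_neqAle eq_sym T0 (le_trans (tau_ge0 p0))// le_cycle_time.
set c := _ / T.
have defect : primitive (unc i) (dep (m k.+1)) - primitive (unc i) (dep (m k))
    - c * (dep (m k.+1) - dep (m k)) @[k --> \oo] --> 0.
  have stepG := integral_step_cvg.
  rewrite -(divfK T0 (\sum_(p | _) _)) -/c in stepG.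
  rewrite -[0](subrr (c * T)); apply: cvgB stepG _.
  by apply: cvgM; [exact: cvg_cst|exact: time_step_cvg].
have T2 : 0 < T / 2 by rewrite divr_gt0.
have /cvgrPdistC_le/(_ _ (mulr_gt0 e0 T2)) small := defect.
have /cvgrPdist_le/(_ _ T2) := time_step_cvg.
apply: filterS2 small => k; rewrite subr0 => small close.
apply: le_trans small _; rewrite ler_wpM2l ?(ltW e0)//; move: close.
rewrite ler_norml => /andP[_]; lra.
Qed.

End Target.

Lemma mean_cycle_uncertainty_cvg :
  mean_cycle_uncertainty xi unc S @[S --> +oo] -->
  (\sum_p subcycle_time xi rho tau p *
     ((B (xi p) - A (xi p)) * tau p ord0 / 2)) / T.
Proof.
have ci i : {within `[0, +oo[, continuous (unc i)}.
  exact: (@traj_continuous _ _ _ _ _ _ _ _ _ _ traj i).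
rewrite (partition_big xi (fun i => i \in codom xi)) => [|p _]; last exact: codom_f.
rewrite mulr_suml.
rewrite (_ : mean_cycle_uncertainty xi unc =
    (fun S => \sum_(i in codom xi) S^-1 * primitive (unc i) S)); last first.
  by apply/funext => S; rewrite /mean_cycle_uncertainty Rintegral_sum_within// mulr_sumr.
apply: cvg_big => [|i /codomP[p0 ->]]; first exact: add_continuous.
exact: target_mean_cvg.
Qed.

End SteadyState.

Theorem theorem3 (R : realType) (V : finType) (E : rel V)
    (rho : V -> V -> R) (A B : V -> R)
    (rho_ge0 : forall i j, E i j -> 0 <= rho i j)
    (A_gt0 : forall i, 0 < A i) (B_gt0 : forall i, 0 < B i)
    (n : nat) (xi : 'I_n.+1 -> V)
    (xi_cycle : forall p, E (xi p) (xi (ordS p)))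
    (teq : 'cV[R]_n.+1)
    (teq_feasible : forall p, 0 <= teq p ord0)
    (teq_stable :
       globally_asymptotically_stable (dwell_step xi rho A B) teq) :
  [/\ diag_mx (gamma_vec xi A B)^T - subcycle_mx R xi \in unitmx,
      teq = steady_dwell xi rho A B
    & forall (arr dep : nat -> R) (unc : V -> R -> R),
        leave_at_zero_trajectory xi rho A B arr dep unc ->
        tour_dwell n arr dep k @[k --> \oo] --> steady_dwell xi rho A B
        /\ mean_cycle_uncertainty xi unc T @[T --> +oo] -->
           2^-1 * ((B_vec xi rho A B (steady_dwell xi rho A B)
                    - A_vec xi rho A B (steady_dwell xi rho A B))^T
                   *m steady_dwell xi rho A B) ord0 ord0].
Proof.
case: teq_stable => eqtau _ attr.
have xi_rho p : 0 <= rho (xi p) (xi (ordS p)) by exact/rho_ge0/xi_cycle.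
have Mu := dwell_mx_unit A_gt0 eqtau attr.
have tauE := equilibrium_steady A_gt0 eqtau Mu.
split=> // arr dep unc traj; rewrite -tauE.
have tau_cvg := attr _ (tour_dwell_orbit xi_rho A_gt0 traj).
split=> //.
rewrite (_ : 2^-1 * _ = (\sum_p subcycle_time xi rho teq p *
    ((B (xi p) - A (xi p)) * teq p ord0 / 2)) / cycle_time xi rho teq).
  exact: mean_cycle_uncertainty_cvg xi_rho A_gt0 traj teq_feasible tau_cvg.
rewrite mxE mulr_sumr mulr_suml; apply: eq_bigr => p _.
by rewrite [X in _ * (X * _) = _]mxE mean_uncertainty_entry//; ring.
Qed.
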